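(* Let $A$, $G_k$ ($k\ge2$), $\beta_j$, $\boldsymbol e_j$, $\boldsymbol e_j^\ast$, $E_{\mathfrak c}$, $E_{\mathfrak s}$, $A_{\mathfrak c}$, $A_{\mathfrak s}$, $\Pi_{\mathfrak s}$ be as in the context, with $m=\dim E_{\mathfrak c}$ and $\mathrm{Re}(\beta_m)>\mathrm{Re}(\beta_{m+1})$. Assume that $A$ is diagonal under its eigenbasis $\{\boldsymbol e_j\in\mathbb C^N: j=1,\dots,N\}$. Let $\mathcal I=\{1,\dots,m\}$ and assume the following cross non-resonance condition: for all $(i_1,\dots,i_k)\in\mathcal I^k$ and all $n\in\{m+1,\dots,N\}$, $$\Big(\langle G_k(\boldsymbol e_{i_1},\dots,\boldsymbol e_{i_k}),\boldsymbol e_n^\ast\rangle\ne0\Big)\Longrightarrow\Big(\sum_{j=1}^k\beta_{i_j}-\beta_n\ne0\Big).$$ Then a solution $h_k:E_{\mathfrak c}\to E_{\mathfrak s}$ to the equation $$Dh_k(\xi)A_{\mathfrak c}\xi-A_{\mathfrak s}h_k(\xi)=\Pi_{\mathfrak s}G_k(\xi),\qquad\xi\in E_{\mathfrak c},$$ exists, and is given by $$h_k(\xi)=\sum_{n=m+1}^N h_{k,n}(\xi)\,\boldsymbol e_n,\qquad \xi=(\xi_1,\dots,\xi_m)\in E_{\mathfrak c},$$ where $h_{k,n}$ is the homogeneous polynomial of degree $k$ in the variables $\xi_1,\dots,\xi_m$ given by $$h_{k,n}(\xi)=\sum_{(i_1,\dots,i_k)\in\mathcal I^k}\frac{\langle G_k(\boldsymbol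 e_{i_1},\dots,\boldsymbol e_{i_k}),\boldsymbol e_n^\ast\rangle}{\sum_{j=1}^k\beta_{i_j}-\beta_n}\,\xi_{i_1}\cdots\xi_{i_k},$$ terms whose numerator vanishes being taken to be zero.
   Context: Consider the ODE system $\frac{\mathrm dy}{\mathrm dt}=Ay+G(y)$ in $\mathbb R^N$, where $A$ is an $N\times N$ real matrix and $G:\mathbb R^N\to\mathbb R^N$ is sufficiently smooth with $G(0)=0$, $DG(0)=0$, and, near the origin, $G(y)=G_k(y,\dots,y)+O(\|y\|^{k+1})$. Here $k\ge2$ and $G_k$ is the leading-order homogeneous term of order $k$ (a $k$-linear map in its $k$ arguments, extended multilinearly to $\mathbb C^N$). $G_k(y)$ is shorthand for $G_k(y,\dots,y)$. The eigenvalues of $A$ counted with multiplicity are $\beta_1,\dots,\beta_N\in\mathbb C$ with eigenvectors $\boldsymbol e_1,\dots,\boldsymbol e_N$ forming a basis of $\mathbb C^N$. They are ordered so that real parts decrease as the index increases and, for equal real parts, imaginary parts decrease. Fix $1\le m<N$ with $\mathrm{Re}(\beta_m)>\mathrm{Re}(\beta_{m+1})$. Set $E_{\mathfrak c}=\mathrm{span}\{\boldsymbol e_1,\dots,\boldsymbol e_m\}$ and $E_{\mathfrak s}=\mathrm{span}\{\boldsymbol e_{m+1},\dots,\boldsymbol e_N\}$, so $\mathbb C^N=E_{\mathfrak c}\oplus E_{\mathfrak s}$. $\Pi_{\mathfrak c},\Pi_{\mathfrak s}$ are the associated canonical projectors, $A_{\mathfrak c}=\Pi_{\mathfrak c}A$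 on $E_{\mathfrak c}$ and $A_{\mathfrak s}=\Pi_{\mathfrak s}A$ on $E_{\mathfrak s}$. A vector $\xi\in E_{\mathfrak c}$ is identified with its coordinates: $\xi=\sum_{i=1}^m\xi_i\boldsymbol e_i$, $\xi_i\in\mathbb C$. $\langle a,b\rangle=\sum_{i=1}^N a_i\overline{b_i}$ is the inner product on $\mathbb C^N$. $\{\boldsymbol e_j^\ast\}_{j=1}^N$ are the eigenvectors of the conjugate transpose $A^\ast$, normalized as the basis dual to $\{\boldsymbol e_j\}$, i.e. $\langle\boldsymbol e_i,\boldsymbol e_j^\ast\rangle=\delta_{ij}$. *)

(* Defs.v *)
From mathcomp Require Import all_boot all_order all_algebra.
From mathcomp Require Import all_classical all_reals all_analysis.
From mathcomp Require Import complex.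
From mathcomp Require mpoly.

(* The notations of mpoly clash with those of the analysis library. *)
Import -(notations) mpoly.

Set Implicit Arguments.
Unset Strict Implicit.
Unset Printing Implicit Defensive.

Import Order.TTheory GRing.Theory Num.Theory numFieldNormedType.Exports.

Local Open Scope classical_set_scope.
Local Open Scope ring_scope.

(* Conventions: vectors are columns; indices are 0-based, so the indices
   1..m and m+1..N of the eigenbasis are here the [j : 'I_N] with [j < m] and
   [m <= j]. The complex numbers are [complex R] for a [realType] R. *)

(* The vector-valued function f is of class C^r: it is differentiable and all
   its directional derivatives are of class C^(r-1). *)
Fixpoint of_class_C (R : realType) (N : nat) (r : nat)
    (f : 'cV[R]_N -> 'cV[R]_N) : Prop :=
  match r with
  | 0 => continuous f
  | r'.+1 => (forall x, differentiable f x) /\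
             (forall v, of_class_C r' (fun x => 'D_v f x))
  end.

(* Linearity in each argument separately; no symmetry is required. *)
Definition multilinear (K : fieldType) (U V : lmodType K) (k : nat)
    (F : ('I_k -> U) -> V) : Prop :=
  forall (i : 'I_k) (u : 'I_k -> U),
    linear (fun x : U => F (dfwith u i x)).

Definition cplx_mx (R : realType) (p q : nat) (M : 'M[R]_(p, q)) :
    'M[complex R]_(p, q) :=
  map_mx (real_complex R) M.

(* F is the multilinear extension to C^N of the real multilinear map G. *)
Definition complex_extension (R : realType) (N k : nat)
    (G : ('I_k -> 'cV[R]_N) -> 'cV[R]_N)
    (F : ('I_k -> 'cV[complex R]_N) -> 'cV[complex R]_N) : Prop :=
  multilinear F /\
  forall u : 'I_k -> 'cV[R]_N, F (fun l => cplx_mx (u l)) = cplx_mx (G u).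

Definition eigenvector (K : fieldType) (N : nat) (M : 'M[K]_N) (b : K)
    (v : 'cV[K]_N) : Prop :=
  v != 0 /\ M *m v = b *: v.

Definition inner (R : realType) (N : nat) (a b : 'cV[complex R]_N) : complex R :=
  \sum_(i < N) a i 0 * Num.conj (b i 0).

Definition conj_transpose (R : realType) (N : nat) (M : 'M[complex R]_N) :
    'M[complex R]_N :=
  map_mx Num.conj M^T.

(* Nonincreasing real parts, ties broken by nonincreasing imaginary parts
   (repeated eigenvalues are allowed). *)
Definition spectrally_ordered (R : realType) (N : nat)
    (beta : 'I_N -> complex R) : Prop :=
  forall i j : 'I_N, (i <= j)%N ->
    complex.Re (beta j) < complex.Re (beta i) \/
    (complex.Re (beta j) = complex.Re (beta i) /\
     complex.Im (beta j) <= complex.Im (beta i)).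

Definition cidx (N m : nat) (hm : (m < N)%N) (i : 'I_m) : 'I_N :=
  widen_ord (ltnW hm) i.

Definition cbasis (R : realType) (N m : nat) (hm : (m < N)%N)
    (e : 'I_N -> 'cV[complex R]_N) : m.-tuple 'cV[complex R]_N :=
  [tuple e (cidx hm i) | i < m].

Definition Ec (R : realType) (N m : nat) (hm : (m < N)%N)
    (e : 'I_N -> 'cV[complex R]_N) : {vspace 'cV[complex R]_N} :=
  <<cbasis hm e>>%VS.

Definition Es (R : realType) (N m : nat)
    (e : 'I_N -> 'cV[complex R]_N) : {vspace 'cV[complex R]_N} :=
  <<[seq e n | n : 'I_N in [pred n : 'I_N | (m <= n)%N]]>>%VS.

Definition Pi_c (R : realType) (N m : nat) (hm : (m < N)%N)
    (e : 'I_N -> 'cV[complex R]_N) : 'End('cV[complex R]_N) :=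
  daddv_pi (Ec hm e) (Es m e).

Definition Pi_s (R : realType) (N m : nat) (hm : (m < N)%N)
    (e : 'I_N -> 'cV[complex R]_N) : 'End('cV[complex R]_N) :=
  daddv_pi (Es m e) (Ec hm e).

(* E_c is identified with C^m through the coordinates along e_1, ..., e_m:
   [of_coords] and [to_coords] are the two directions of that identification. *)
Definition of_coords (R : realType) (N m : nat) (hm : (m < N)%N)
    (e : 'I_N -> 'cV[complex R]_N) (xi : 'cV[complex R]_m) :
    'cV[complex R]_N :=
  \sum_(i < m) xi i 0 *: e (cidx hm i).

Definition to_coords (R : realType) (N m : nat) (hm : (m < N)%N)
    (e : 'I_N -> 'cV[complex R]_N) (y : 'cV[complex R]_N) :
    'cV[complex R]_m :=
  \col_(i < m) coord (cbasis hm e) i y.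

(* A_c = Pi_c A on E_c, read in coordinates. *)
Definition A_c (R : realType) (N m : nat) (hm : (m < N)%N)
    (e : 'I_N -> 'cV[complex R]_N) (M : 'M[complex R]_N)
    (xi : 'cV[complex R]_m) : 'cV[complex R]_m :=
  to_coords hm e (Pi_c hm e (M *m of_coords hm e xi)).

Definition A_s (R : realType) (N m : nat) (hm : (m < N)%N)
    (e : 'I_N -> 'cV[complex R]_N) (M : 'M[complex R]_N)
    (y : 'cV[complex R]_N) : 'cV[complex R]_N :=
  Pi_s hm e (M *m y).

(* h maps E_c (in coordinates) to E_s and satisfies
   Dh(xi) A_c xi - A_s h(xi) = Pi_s G_k(xi) on E_c, where Dh(xi) is the complex
   Frechet derivative. Differentiability is stated separately because ['d h xi]
   is a junk value when h is not differentiable at xi. *)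
Definition invariance_solution (R : realType) (N m k : nat) (hm : (m < N)%N)
    (e : 'I_N -> 'cV[complex R]_N) (M : 'M[complex R]_N)
    (F : ('I_k -> 'cV[complex R]_N) -> 'cV[complex R]_N)
    (h : 'cV[complex R]_m -> 'cV[complex R]_N) : Prop :=
  (forall xi, h xi \in Es m e) /\
  (forall xi, differentiable h xi /\
     'd h xi (A_c hm e M xi) - A_s hm e M (h xi)
       = Pi_s hm e (F (fun=> of_coords hm e xi))).

Definition cross_nonresonance (R : realType) (N m k : nat) (hm : (m < N)%N)
    (beta : 'I_N -> complex R) (e es : 'I_N -> 'cV[complex R]_N)
    (F : ('I_k -> 'cV[complex R]_N) -> 'cV[complex R]_N) : Prop :=
  forall (I : {ffun 'I_k -> 'I_m}) (n : 'I_N), (m <= n)%N ->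
    inner (F (fun j => e (cidx hm (I j)))) (es n) != 0 ->
    \sum_(j < k) beta (cidx hm (I j)) - beta n != 0.

(* A term with zero numerator is 0 whatever its denominator, since division
   is total. *)
Definition h_component (R : realType) (N m k : nat) (hm : (m < N)%N)
    (beta : 'I_N -> complex R) (e es : 'I_N -> 'cV[complex R]_N)
    (F : ('I_k -> 'cV[complex R]_N) -> 'cV[complex R]_N)
    (n : 'I_N) (xi : 'cV[complex R]_m) : complex R :=
  \sum_(I : {ffun 'I_k -> 'I_m})
    inner (F (fun j => e (cidx hm (I j)))) (es n)
      / (\sum_(j < k) beta (cidx hm (I j)) - beta n)
      * \prod_(j < k) xi (I j) 0.

(* As usual the zero polynomial counts as homogeneous of every degree. *)
Definition homogeneous_polynomial (R : realType) (m k : nat)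
    (f : 'cV[complex R]_m -> complex R) : Prop :=
  exists p : mpoly m (complex R),
    p \is ishomog1 k (Measure.clone m (@mdeg m) _) /\
    forall xi, f xi = meval (fun i => xi i 0) p.

(* Main.v *)
From HB Require Import structures.
Require Import Defs.
From mathcomp Require Import all_boot all_order all_algebra.
From mathcomp Require Import all_classical all_reals all_analysis.
From mathcomp Require Import complex ring.
From mathcomp Require mpoly.

Import -(notations) mpoly.

Set Implicit Arguments.
Unset Strict Implicit.
Unset Printing Implicit Defensive.

Import Order.TTheory GRing.Theory Num.Theory numFieldNormedType.Exports.

Local Open Scope classical_set_scope.
Local Open Scope ring_scope.

(** Take a monomial map xi |-> xi_{i_1} ... xi_{i_k} e_n with e_n in E_s. In the
    eigenbasis A_c is diagonal, so Dh A_c xi applies the derivation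
    sum_i beta_i xi_i d/dxi_i, which multiplies the monomial by
    beta_{i_1} + ... + beta_{i_k} (Leibniz rule, [diff_monomial_diagonal]);
    A_s multiplies e_n by beta_n. Hence the left-hand side
    h |-> Dh A_c xi - A_s h acts on that map as multiplication by the divisor
    sum_j beta_{i_j} - beta_n.

    On the other side, multilinearity expands G_k(xi, ..., xi) into the sum
    over all index words of xi_{i_1} ... xi_{i_k} G_k(e_{i_1}, ..., e_{i_k})
    ([multilinear_expansion]), and Pi_s extracts from each value its
    coordinates < . , e_n^*> with e_n in E_s ([Pi_sE]). The equation is solved
    by dividing coefficient by coefficient; nonresonance says that each
    divisor under a nonzero coefficient is nonzero, and a zero coefficient
    needs no division ([homological_equation]).

    Pi_s is given by the direct sum of the two spans and the coordinates on E_c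
    are taken along their own basis; both are reduced to the coordinates
    along the full eigenbasis, which by duality are the inner products with
    the e_n^* ([inner_dual_coord]). *)

(** * Expansion of a multilinear map on linear combinations *)

Section MultilinearExpansion.
Context {K : fieldType} {U V : lmodType K}.

(** Bundles one slot of a multilinear map as a [{linear _ -> _}], so that the
    generic lemmas on sums and scalars apply to it. *)
Lemma multilinear_slot_linear (k : nat) (F : ('I_k -> U) -> V) (i : 'I_k)
    (u : 'I_k -> U) : multilinear F ->
  exists f : {linear U -> V}, forall x, F (dfwith u i x) = f x.
Proof.
move=> /(_ i u) Flin.
pose f := fun x => F (dfwith u i x).
pose fM := GRing.isLinear.Build K U V *:%R f Flin.
pose fL : {linear U -> V} := HB.pack f fM.
by exists fL.
Qed.

Lemma dfwith_self (T : Type) (k : nat) (u : 'I_k -> T) (i : 'I_k) :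
  dfwith u i (u i) = u.
Proof. by apply/funext => l; case: dfwithP. Qed.

Definition fcons (T : Type) (k : nat) (x : T) (f : 'I_k -> T) : 'I_k.+1 -> T :=
  fun l => oapp f x (unlift ord0 l).

Lemma fcons_ord0 (T : Type) (k : nat) (x : T) (f : 'I_k -> T) :
  fcons x f ord0 = x.
Proof. by rewrite /fcons unlift_none. Qed.

Lemma fcons_lift (T : Type) (k : nat) (x : T) (f : 'I_k -> T) (j : 'I_k) :
  fcons x f (lift ord0 j) = f j.
Proof. by rewrite /fcons liftK. Qed.

Lemma fcons_eta (T : Type) (k : nat) (f : 'I_k.+1 -> T) :
  fcons (f ord0) (fun j => f (lift ord0 j)) = f.
Proof.
apply/funext => l.
by case: (unliftP ord0 l) => [j|] ->; rewrite ?fcons_lift ?fcons_ord0.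
Qed.

Lemma dfwith_fcons0 (T : Type) (k : nat) (f : 'I_k.+1 -> T) (x : T) :
  dfwith f ord0 x = fcons x (fun j => f (lift ord0 j)).
Proof.
apply/funext => l; case: (unliftP ord0 l) => [j|] ->.
  by rewrite fcons_lift dfwithout ?neq_lift.
by rewrite fcons_ord0 dfwithin.
Qed.

Lemma dfwith_fcons_lift (T : Type) (k : nat) (a x : T) (f : 'I_k -> T)
    (j : 'I_k) :
  dfwith (fcons a f) (lift ord0 j) x = fcons a (dfwith f j x).
Proof.
apply/funext => l; case: (unliftP ord0 l) => [i|] ->; last first.
  by rewrite dfwithout 1?eq_sym ?neq_lift// !fcons_ord0.
rewrite fcons_lift; have [->|ij] := eqVneq j i; first by rewrite !dfwithin.
by rewrite !dfwithout ?fcons_lift// (inj_eq lift_inj).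
Qed.

(** Freezing the first argument leaves a multilinear map in the others: this
    is what drives the induction on the number of arguments. *)
Lemma multilinear_fcons (k : nat) (F : ('I_k.+1 -> U) -> V) (a : U) :
  multilinear F -> multilinear (fun f => F (fcons a f)).
Proof.
move=> Fmul i u c x y /=; rewrite -!dfwith_fcons_lift; exact: Fmul.
Qed.

(** Induction on the number of slots: expand the first slot by linearity,
    the others by the induction hypothesis with the first one frozen, and
    identify a first index and a word of length k with a word of length
    k + 1. *)
Lemma multilinear_sum (m k : nat) (F : ('I_k -> U) -> V)
    (u : 'I_k -> 'I_m -> U) : multilinear F ->
  F (fun l => \sum_(i < m) u l i)
    = \sum_(I : {ffun 'I_k -> 'I_m}) F (fun l => u l (I l)).
Proof.
elim: k F u => [|k IHk] F u Fmul.
  rewrite (big_pred1 (ffun0 (card_ord 0))) => [|I].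
    by congr (F _); apply/funext => -[].
  by apply/esym/eqP/ffunP => -[].
have [f Ff] := multilinear_slot_linear ord0 (fun l => \sum_i u l i) Fmul.
rewrite -[X in F X](dfwith_self _ ord0) Ff linear_sum.
have step (i : 'I_m) :
    f (u ord0 i) = \sum_(I : {ffun 'I_k -> 'I_m})
      F (fcons (u ord0 i) (fun j => u (lift ord0 j) (I j))).
  rewrite -Ff dfwith_fcons0.
  exact: (IHk (fun g => F (fcons (u ord0 i) g)) (fun j => u (lift ord0 j))
    (multilinear_fcons _ _)).
under eq_bigr do rewrite step.
rewrite pair_bigA /=.
pose h (p : 'I_m * {ffun 'I_k -> 'I_m}) : {ffun 'I_k.+1 -> 'I_m} :=
  [ffun l => fcons p.1 p.2 l].
pose h' (I : {ffun 'I_k.+1 -> 'I_m}) : 'I_m * {ffun 'I_k -> 'I_m} :=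
  (I ord0, [ffun j => I (lift ord0 j)]).
rewrite [RHS](reindex h) /=; last first.
  exists h' => [[i I] _|I _]; rewrite /h /h' /=.
    rewrite ffunE fcons_ord0; congr pair.
    by apply/ffunP => j; rewrite !ffunE fcons_lift.
  apply/ffunP => l; rewrite ffunE -[in RHS](fcons_eta I).
  by congr (fcons _ _ l); apply/funext => j; rewrite ffunE.
apply: eq_bigr => -[i I] _; congr (F _); apply/funext => l /=.
rewrite /h ffunE /=.
by case: (unliftP ord0 l) => [j|] ->; rewrite ?fcons_lift ?fcons_ord0.
Qed.

Lemma multilinear_scale (k : nat) (F : ('I_k -> U) -> V) (a : 'I_k -> K)
    (u : 'I_k -> U) : multilinear F ->
  F (fun l => a l *: u l) = (\prod_(l < k) a l) *: F u.
Proof.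
move=> Fmul.
(* The scalars are pulled out one slot at a time: [s] lists the slots that
   still carry theirs. *)
have slotwise (s : seq 'I_k) : uniq s ->
    F (fun l => if l \in s then a l *: u l else u l)
      = (\prod_(l <- s) a l) *: F u.
  elim: s => [|i s IHs] /= => [_|/andP[iNs /IHs{}IHs]].
    by rewrite big_nil scale1r.
  rewrite big_cons -scalerA -IHs.
  set w := (fun l => if l \in s then _ else _).
  have wi : w i = u i by rewrite /w (negPf iNs).
  have [f Ff] := multilinear_slot_linear i w Fmul.
  rewrite -[X in _ *: F X](dfwith_self _ i) Ff -linearZ -Ff wi.
  congr (F _); apply/funext => l; rewrite inE.
  have [->|li] := eqVneq l i; first by rewrite dfwithin.
  by rewrite dfwithout 1?eq_sym.
rewrite -(slotwise _ (index_enum_uniq _)).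
by congr (F _); apply/funext => l; rewrite mem_index_enum.
Qed.

Lemma multilinear_expansion (m k : nat) (F : ('I_k -> U) -> V)
    (xi : 'I_m -> K) (e : 'I_m -> U) : multilinear F ->
  F (fun=> \sum_(i < m) xi i *: e i)
    = \sum_(I : {ffun 'I_k -> 'I_m})
        (\prod_(l < k) xi (I l)) *: F (fun l => e (I l)).
Proof.
move=> Fmul; rewrite (multilinear_sum (fun=> fun i => xi i *: e i) Fmul).
apply: eq_bigr => I _.
exact: (multilinear_scale (fun l => xi (I l)) (fun l => e (I l)) Fmul).
Qed.

End MultilinearExpansion.

(** * Monomials as eigenvectors of a diagonal derivation *)

Section DiagonalDerivation.
Context {K : numFieldType}.

Lemma diff_big_sum (V W : normedModType K) (T : Type) (s : seq T)
    (P : pred T) (f : T -> V -> W) (x : V) :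
  (forall i, P i -> differentiable (f i) x) ->
  differentiable (fun y => \sum_(i <- s | P i) f i y) x /\
  (forall v, 'd (fun y => \sum_(i <- s | P i) f i y) x v
     = \sum_(i <- s | P i) 'd (f i) x v).
Proof.
move=> df; elim: s => [|i s [dIH IH]].
  have -> : (fun y => \sum_(i <- [::] | P i) f i y) = cst 0.
    by apply/funext => y; rewrite big_nil.
  by split=> [|v]; rewrite ?diff_cst ?big_nil//; exact: differentiable_cst.
have [Pi|nPi] := boolP (P i); last first.
  have -> : (fun y => \sum_(j <- i :: s | P j) f j y)
      = (fun y => \sum_(j <- s | P j) f j y).
    by apply/funext => y; rewrite big_cons (negPf nPi).
  by split=> // v; rewrite big_cons (negPf nPi).
have -> : (fun y => \sum_(j <- i :: s | P j) f j y)
    = f i + (fun y => \sum_(j <- s | P j) f j y).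
  by apply/funext => y; rewrite big_cons Pi.
split=> [|v]; first by apply: differentiableD => //; exact: df.
by rewrite (diffD (df _ Pi) dIH) big_cons Pi /= IH.
Qed.

Lemma diff_coord (m n : nat) (i : 'I_m) (j : 'I_n) (x v : 'M[K]_(m, n)) :
  'd (fun y : 'M[K]_(m, n) => y i j : K^o) x v = v i j.
Proof.
have flin : linear (fun y : 'M[K]_(m, n) => y i j : K^o).
  by move=> a y z; rewrite !mxE.
pose fM := GRing.isLinear.Build K 'M[K]_(m, n) K^o *:%R _ flin.
pose f : {linear 'M[K]_(m, n) -> K^o} :=
  HB.pack (fun y : 'M[K]_(m, n) => y i j : K^o) fM.
by rewrite (@diff_lin _ _ _ f)//; exact: coord_continuous.
Qed.

(** The vector at which the differential is taken is the value at [x] of the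
    diagonal vector field of eigenvalues [b]. By the Leibniz rule each factor
    of the product contributes its own eigenvalue. *)
Lemma diff_monomial_diagonal (m : nat) (T : Type) (s : seq T) (I : T -> 'I_m)
    (b : 'I_m -> K) (x : 'cV[K]_m) :
  let mono := fun y : 'cV[K]_m => \prod_(t <- s) y (I t) 0 : K^o in
  differentiable mono x /\
  'd mono x (\col_i (b i * x i 0)) = (\sum_(t <- s) b (I t)) * mono x.
Proof.
elim: s => [|t s [dIH IH]] /=.
  have -> : (fun y : 'cV[K]_m => \prod_(t <- [::]) y (I t) 0 : K^o) = cst 1.
    by apply/funext => y; rewrite big_nil.
  by rewrite diff_cst big_nil mul0r; split=> //; exact: differentiable_cst.
have -> : (fun y : 'cV[K]_m => \prod_(r <- t :: s) y (I r) 0 : K^o)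
    = (fun y => y (I t) 0 : K^o) * (fun y => \prod_(r <- s) y (I r) 0 : K^o).
  by apply/funext => y; rewrite big_cons.
have dt := differentiable_coord x (I t) 0.
split; first exact: differentiableM.
rewrite (diffM dt dIH) /= !fctE /= IH diff_coord mxE !big_cons.
by rewrite /GRing.scale /=; ring.
Qed.

Lemma diff_polynomial_diagonal (m k : nat) (T : finType)
    (I : T -> 'I_k -> 'I_m) (c : T -> K) (b : 'I_m -> K) (x : 'cV[K]_m) :
  let p := fun y : 'cV[K]_m => \sum_t c t * \prod_(j < k) y (I t j) 0 : K^o in
  differentiable p x /\
  'd p x (\col_i (b i * x i 0)) =
    \sum_t c t * ((\sum_(j < k) b (I t j)) * \prod_(j < k) x (I t j) 0).
Proof.
pose mono t (y : 'cV[K]_m) : K^o := \prod_(j < k) y (I t j) 0.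
have dmono t := diff_monomial_diagonal (index_enum 'I_k) (I t) b x.
have dterm t : differentiable (c t *: mono t) x.
  by apply: differentiableZ; have [] := dmono t.
have [dp dpE] := diff_big_sum (index_enum _) (P := xpredT) (fun t _ => dterm t).
split; first exact: dp.
rewrite [LHS]dpE; apply: eq_bigr => t _.
by have [dt dtE] := dmono t; rewrite diffZ//=; rewrite [X in _ *: X]dtE.
Qed.

End DiagonalDerivation.

(** * Projections along a partition of a basis *)

Section ProjectionAlongBasis.
Context {K : fieldType} {vT : vectType K} {n : nat}.
Variable e : 'I_n -> vT.
Hypothesis e_basis : basis_of fullv [tuple e j | j < n].

Lemma coord_expand (y : vT) :
  y = \sum_(i < n) coord [tuple e j | j < n] i y *: e i.
Proof.
rewrite [LHS](coord_basis e_basis (memvf y)).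
by apply: eq_bigr => i _; rewrite -tnth_nth tnth_mktuple.
Qed.

Lemma coord_basis_vector (i j : 'I_n) :
  coord [tuple e j | j < n] i (e j) = (i == j)%:R.
Proof.
have := coord_free j i (basis_free e_basis).
by rewrite -tnth_nth tnth_mktuple eq_sym.
Qed.

Lemma coord_span_eq0 (i : 'I_n) (s : seq vT) :
  {in s, forall v, coord [tuple e j | j < n] i v = 0} ->
  {in << s >>%VS, forall v, coord [tuple e j | j < n] i v = 0}.
Proof.
move=> s0 v; rewrite -[s]/(val (in_tuple s)) => /coord_span ->.
rewrite linear_sum big1// => j _; rewrite linearZ /= s0 ?mulr0//.
exact: mem_nth.
Qed.

(** The coordinates along the whole basis detect both subspaces, so these meet
    trivially. Splitting [y] along the basis into its part in [U] and its part
    in [W], the projection fixes the first and kills the second. *)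
Lemma daddv_pi_basis (P : pred 'I_n) (U W : {vspace vT}) (y : vT) :
    (forall i, e i \in if P i then U else W) ->
    (forall i, {in if P i then W else U, forall v,
       coord [tuple e j | j < n] i v = 0}) ->
  daddv_pi U W y = \sum_(i < n | P i) coord [tuple e j | j < n] i y *: e i.
Proof.
move=> eUW coord0.
have UW0 : (U :&: W = 0)%VS.
  apply/eqP; rewrite -subv0; apply/subvP => v; rewrite memv_cap memv0.
  move=> /andP[vU vW]; rewrite (coord_expand v) big1// => i _.
  by rewrite coord0 ?scale0r//; case: ifP.
have WU0 : (W :&: U = 0)%VS by rewrite capvC.
have sum_in (Q : pred 'I_n) (X : {vspace vT}) : (forall i, Q i -> e i \in X) ->
    \sum_(i < n | Q i) coord [tuple e j | j < n] i y *: e i \in X.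
  by move=> eX; apply: memv_suml => i /eX; exact: memvZ.
have uU := sum_in P U (fun i Pi => ltac:(by have := eUW i; rewrite Pi)).
have wW := sum_in (fun i => ~~ P i) W
  (fun i nPi => ltac:(by have := eUW i; rewrite (negPf nPi))).
rewrite [in LHS](coord_expand y) (bigID P) /= linearD /= (daddv_pi_id UW0 uU).
have := daddv_pi_add UW0 (subvP (addvSr U W) _ wW).
by rewrite (daddv_pi_id WU0 wW) -[RHS]add0r => /addIr ->; rewrite addr0.
Qed.

End ProjectionAlongBasis.

(** * Homogeneous polynomials *)

Lemma homogeneous_polynomial_sum (R : realType) (m k : nat) (T : finType)
    (c : T -> complex R) (I : T -> 'I_k -> 'I_m) :
  homogeneous_polynomial k
    (fun xi => \sum_t c t * \prod_(j < k) xi (I t j) 0).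
Proof.
pose mon t : mpoly m (complex R) :=
  \prod_(j < k) mpolyX _ (mnm1 (I t j)).
exists (\sum_t c t *: mon t); split=> [|xi].
  apply: rpred_sum => t _; apply: dhomogZ.
  (* The degree k is written as a sum of ones over the factors, to be matched
     with the product factor by factor. *)
  rewrite -[X in ishomog1 X]card_ord -sum1_card /mon.
  elim/big_rec2: _ => [|j p d _ IH]; first exact: dhomog1.
  by apply: dhomogM IH; rewrite dhomogX /= mdeg1.
rewrite raddf_sum; apply: eq_bigr => t _; rewrite /= mevalZ rmorph_prod.
by congr (_ * _); apply: eq_bigr => j _; rewrite /= mevalXU.
Qed.

(** * The invariance equation in the eigenbasis *)

Section InvarianceEquation.
Context {R : realType} {N m : nat} (hm : (m < N)%N).
Variables (e es : 'I_N -> 'cV[complex R]_N).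
Hypothesis e_basis : basis_of fullv [tuple e j | j < N].
Hypothesis e_es_dual : forall i j, inner (e i) (es j) = (i == j)%:R.

Lemma inner_dual_coord (n : 'I_N) (y : 'cV[complex R]_N) :
  inner y (es n) = coord [tuple e j | j < N] n y.
Proof.
rewrite {1}(coord_expand e_basis y) /inner.
transitivity (\sum_(i < N) coord [tuple e j | j < N] i y * inner (e i) (es n)).
  under [RHS]eq_bigr do rewrite /inner mulr_sumr.
  rewrite exchange_big; apply: eq_bigr => l _ /=.
  by rewrite summxE mulr_suml; apply: eq_bigr => i _; rewrite mxE mulrA.
rewrite (bigD1 n)//= e_es_dual eqxx mulr1 big1 ?addr0// => i /negPf ni.
by rewrite e_es_dual ni mulr0.
Qed.

Lemma cidx_surj (i : 'I_N) : (i < m)%N -> exists j, i = cidx hm j.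
Proof. by move=> im; exists (Ordinal im); apply/val_inj. Qed.

Lemma Ec_basis_vector (j : 'I_m) : e (cidx hm j) \in Ec hm e.
Proof.
by apply: memv_span; apply/tnthP; exists j; rewrite tnth_mktuple.
Qed.

Lemma Es_basis_vector (n : 'I_N) : (m <= n)%N -> e n \in Es m e.
Proof. by move=> mn; apply: memv_span; apply/fintype.imageP; exists n. Qed.

Lemma coord_Ec (n : 'I_N) : (m <= n)%N ->
  {in Ec hm e, forall v, coord [tuple e j | j < N] n v = 0}.
Proof.
move=> mn; apply: coord_span_eq0 => v /tnthP[j ->].
rewrite tnth_mktuple coord_basis_vector//; case: eqP => // nj.
by move: mn; rewrite nj leqNgt /= ltn_ord.
Qed.

Lemma coord_Es (i : 'I_N) : (i < m)%N ->
  {in Es m e, forall v, coord [tuple e j | j < N] i v = 0}.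
Proof.
move=> im; apply: coord_span_eq0 => v /fintype.imageP[n].
rewrite inE => mn ->; rewrite coord_basis_vector//; case: eqP => // ni.
by move: mn; rewrite -ni leqNgt im.
Qed.

Lemma Pi_sE (y : 'cV[complex R]_N) :
  Pi_s hm e y = \sum_(n < N | (m <= n)%N) inner y (es n) *: e n.
Proof.
rewrite /Pi_s (daddv_pi_basis e_basis (P := fun n : 'I_N => (m <= n)%N)).
- by apply: eq_bigr => n _; rewrite inner_dual_coord.
- move=> n; case: leqP => [|/cidx_surj[j ->]]; first exact: Es_basis_vector.
  exact: Ec_basis_vector.
- by move=> n; case: leqP => ?; [exact: coord_Ec|exact: coord_Es].
Qed.

Lemma Pi_cE (v : 'cV[complex R]_N) : v \in Ec hm e -> Pi_c hm e v = v.
Proof.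
move=> vE; rewrite /Pi_c.
rewrite (daddv_pi_basis e_basis (P := fun n : 'I_N => (n < m)%N)).
- rewrite [RHS](coord_expand e_basis).
  rewrite [RHS](bigID (fun n : 'I_N => (n < m)%N)) /=.
  rewrite [X in _ + X]big1 ?addr0// => n; rewrite -leqNgt => mn.
  by rewrite coord_Ec ?scale0r.
- move=> n; case: ltnP => [/cidx_surj[j ->]|]; last exact: Es_basis_vector.
  exact: Ec_basis_vector.
- by move=> n; case: ltnP => ?; [exact: coord_Es|exact: coord_Ec].
Qed.

(** [to_coords] reads coordinates along the basis of E_c alone; they are the
    right ones because that family is free, as the coordinates along the whole
    eigenbasis show. *)
Lemma of_coordsK (xi : 'cV[complex R]_m) :
  to_coords hm e (of_coords hm e xi) = xi.
Proof.
have cbasisE (j : 'I_m) : (cbasis hm e)`_j = e (cidx hm j).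
  by rewrite -tnth_nth tnth_mktuple.
have free_c : free (cbasis hm e).
  apply/freeP => c; under eq_bigr do rewrite cbasisE.
  move=> c0 i; have := congr1 (coord [tuple e j | j < N] (cidx hm i)) c0.
  rewrite linear0 linear_sum (bigD1 i)//= linearZ /=.
  rewrite coord_basis_vector// eqxx mulr1 big1 ?addr0// => j ji.
  rewrite linearZ /= coord_basis_vector// -val_eqE /= eq_sym.
  by rewrite (_ : (_ == _) = false) ?mulr0//; exact: negPf ji.
apply/colP => i; rewrite mxE /of_coords.
under eq_bigr do rewrite -cbasisE.
exact: coord_sum_free.
Qed.

Section Eigenbasis.
Variables (M : 'M[complex R]_N) (beta : 'I_N -> complex R).
Hypothesis e_eigen : forall j, M *m e j = beta j *: e j.

Lemma A_cE (xi : 'cV[complex R]_m) :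
  A_c hm e M xi = \col_i (beta (cidx hm i) * xi i 0).
Proof.
rewrite /A_c Pi_cE.
  rewrite -[RHS]of_coordsK; congr to_coords.
  rewrite /of_coords mulmx_sumr; apply: eq_bigr => i _.
  by rewrite -scalemxAr e_eigen scalerA mxE mulrC.
rewrite /of_coords mulmx_sumr; apply: memv_suml => i _.
by rewrite -scalemxAr e_eigen !memvZ// Ec_basis_vector.
Qed.

Lemma A_s_sum (a : 'I_N -> complex R) :
  A_s hm e M (\sum_(n < N | (m <= n)%N) a n *: e n)
    = \sum_(n < N | (m <= n)%N) (beta n * a n) *: e n.
Proof.
rewrite /A_s Pi_sE; apply: eq_bigr => n mn; congr (_ *: _).
rewrite inner_dual_coord mulmx_sumr linear_sum (bigD1 n)//=.
rewrite -scalemxAr e_eigen scalerA linearZ /= coord_basis_vector// eqxx mulr1.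
rewrite big1 ?addr0 1?mulrC// => i /andP[_ /negPf ni].
rewrite -scalemxAr e_eigen scalerA linearZ /= coord_basis_vector//.
by rewrite eq_sym ni mulr0.
Qed.

End Eigenbasis.

(** Both sides are compared coefficient by coefficient, for each basis vector
    e_n of E_s and each index word I: the left-hand side multiplies the
    coefficient of h by the divisor that the definition of h divides by. *)
Lemma homological_equation (k : nat)
    (F : ('I_k -> 'cV[complex R]_N) -> 'cV[complex R]_N)
    (M : 'M[complex R]_N) (beta : 'I_N -> complex R) :
    multilinear F -> (forall j, M *m e j = beta j *: e j) ->
    cross_nonresonance hm beta e es F ->
  invariance_solution hm e M F (fun xi =>
    \sum_(n < N | (m <= n)%N) h_component hm beta e es F n xi *: e n).
Proof.
move=> Fmul Me nonres; split=> [xi|xi].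
  by apply: memv_suml => n mn; apply: memvZ; exact: Es_basis_vector.
pose f (n : 'I_N) (y : 'cV[complex R]_m) :=
  h_component hm beta e es F n y *: e n.
have dcomp n := @diff_polynomial_diagonal (complex R) m k
  {ffun 'I_k -> 'I_m} (fun I => I)
  (fun I => inner (F (fun j => e (cidx hm (I j)))) (es n)
    / (\sum_(j < k) beta (cidx hm (I j)) - beta n))
  (fun i => beta (cidx hm i)) xi.
have [dh dhE] := @diff_big_sum _ _ _ _ (index_enum _)
  (fun n : 'I_N => (m <= n)%N) f xi
  (fun n _ => differentiableZl (e n) (dcomp n).1).
split; first exact: dh.
rewrite (A_cE Me) [X in X - _ = _]dhE (A_s_sum Me) Pi_sE -sumrB.
apply: eq_bigr => n mn; rewrite diffZl; last exact: (dcomp n).1.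
rewrite (dcomp n).2 -scalerBl; congr (_ *: _).
rewrite (multilinear_expansion (fun i => xi i 0) (fun i => e (cidx hm i)) Fmul).
rewrite [in RHS]inner_dual_coord linear_sum mulr_sumr -sumrB.
apply: eq_bigr => I _; rewrite [RHS]linearZ /= -inner_dual_coord.
(* Where the numerator vanishes both sides are 0, whatever the divisor. *)
have [->|num0] := eqVneq (inner (F (fun j => e (cidx hm (I j)))) (es n)) 0.
  by rewrite !mul0r !mulr0 subrr.
by have den0 := nonres I n mn num0; field.
Qed.

End InvarianceEquation.

Theorem theorem2 (R : realType) (N m k : nat)
  (hk : (2 <= k)%N) (hm1 : (1 <= m)%N) (hm : (m < N)%N)
  (A : 'M[R]_N) (G : 'cV[R]_N -> 'cV[R]_N)
  (Gk : ('I_k -> 'cV[R]_N) -> 'cV[R]_N)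
  (GkC : ('I_k -> 'cV[complex R]_N) -> 'cV[complex R]_N)
  (beta : 'I_N -> complex R) (e es : 'I_N -> 'cV[complex R]_N)
  (G_smooth : of_class_C k.+1 G)
  (G_0 : G 0 = 0)
  (DG_0 : forall v, 'd G (0 : 'cV[R]_N) v = 0)
  (Gk_multilinear : multilinear Gk)
  (G_expansion : (fun y => G y - Gk (fun=> y))
     =O_ (0 : 'cV[R]_N) (fun y => `|y| ^+ k.+1 : R^o))
  (GkC_extension : complex_extension Gk GkC)
  (e_basis : basis_of fullv [tuple e j | j < N])
  (e_eigen : forall j, eigenvector (cplx_mx A) (beta j) (e j))
  (es_eigen : forall j,
     exists mu, eigenvector (conj_transpose (cplx_mx A)) mu (es j))
  (e_es_dual : forall i j, inner (e i) (es j) = (i == j)%:R)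
  (beta_ordered : spectrally_ordered beta)
  (spectral_gap : forall i j : 'I_N, i.+1 = m -> j = m :> nat ->
     complex.Re (beta j) < complex.Re (beta i))
  (nonresonance : cross_nonresonance hm beta e es GkC) :
  exists h : 'cV[complex R]_m -> 'cV[complex R]_N,
    [/\ invariance_solution hm e (cplx_mx A) GkC h,
        (forall xi, h xi =
           \sum_(n < N | (m <= n)%N) h_component hm beta e es GkC n xi *: e n)
      & (forall n : 'I_N, (m <= n)%N ->
           homogeneous_polynomial k (h_component hm beta e es GkC n))].
Proof.
have [Fmul _] := GkC_extension.
exists (fun xi =>
  \sum_(n < N | (m <= n)%N) h_component hm beta e es GkC n xi *: e n).
split=> [|//|n mn]; last exact: homogeneous_polynomial_sum.
by apply: homological_equation => // j; have [] := e_eigen j.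
Qed.
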